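(* With the notation below, the $\varphi$-Koszul complex $\mathcal{FK}_\bullet(x_1,\ldots,x_n)$ is a (finite) free resolution of $S/I_n$ in the category of left $S[\Theta;\varphi]$-modules, where $I_n=\langle x_1,\ldots,x_n\rangle$; that is, $H_l(\mathcal{FK}_\bullet(x_1,\ldots,x_n))=0$ for all $l\geq 1$ and $H_0(\mathcal{FK}_\bullet(x_1,\ldots,x_n))\cong S/I_n$ as left $S[\Theta;\varphi]$-modules.
   Context: Let $\mathbb{K}$ be a commutative ring and $S=\mathbb{K}[x_1,\ldots,x_n]$. Let $\varphi:S\to S$ be a flat $\mathbb{K}$-algebra endomorphism with $\varphi(x_i)\in\langle x_i\rangle$ for each $i$, and fix nonzero $s_1,\ldots,s_n\in S$ with $\varphi(x_i)=s_ix_i$. The left skew polynomial ring $S[\Theta;\varphi]$ is the ring which is a free left $S$-module with basis $\{\Theta^i\}_{i\geq0}$ and multiplication determined by $\Theta a=\varphi(a)\Theta$ for $a\in S$. $S/I_n$ is a left $S[\Theta;\varphi]$-module with $S$ acting naturally and $\Theta$ acting by the map induced by $\varphi$ (well defined since $\varphi(I_n)\subseteq I_n$). For $J=\{j_1<\cdots<j_k\}\subseteq\{1,\ldots,n\}$ write $s_J=s_{j_1}\cdots s_{j_k}$ (with $s_\emptyset=1$) and $\mathbf{e}_J=\mathbf{e}_{j_1}\wedge\cdots\wedge\mathbf{e}_{j_k}$. The $\varphi$-Koszul complex $\mathcal{FK}_\bullet(x_1,\ldots,x_n)$ is defined as follows: for $0\leq l\leq n+1$, $\mathcal{FK}_l$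 is the free left $S[\Theta;\varphi]$-module with basis $\{\mathbf{e}_I : |I|=l\}\cup\{\mathbf{e}_J\wedge u : |J|=l-1\}$ (so $\mathcal{FK}_0=S[\Theta;\varphi]$ with basis $\mathbf{e}_\emptyset$, and $\mathcal{FK}_{n+1}$ has the single basis element $\mathbf{e}_{\{1,\ldots,n\}}\wedge u$), and $\partial_l:\mathcal{FK}_l\to\mathcal{FK}_{l-1}$ ($1\le l\le n+1$; $\partial_0=\partial_{n+2}=0$) is the left $S[\Theta;\varphi]$-linear map given on basis elements by $\partial_l(\mathbf{e}_I)=\sum_{r=1}^{l}(-1)^{r-1}x_{i_r}\,\mathbf{e}_{I\setminus\{i_r\}}$ for $I=\{i_1<\cdots<i_l\}$, and $\partial_l(\mathbf{e}_J\wedge u)=(-1)^{l-1}(\Theta-s_J)\,\mathbf{e}_J+\sum_{r=1}^{l-1}(-1)^{r-1}\varphi(x_{j_r})\,\mathbf{e}_{J\setminus\{j_r\}}\wedge u$ for $J=\{j_1<\cdots<j_{l-1}\}$ (in particular $\partial_1(u)=\Theta-1$). *)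

(* Defs.v *)
From HB Require Import structures.
From mathcomp Require Import all_boot all_order all_algebra.
Set Implicit Arguments. Unset Strict Implicit. Unset Printing Implicit Defensive.
Import Order.TTheory GRing.Theory.
Local Open Scope ring_scope.

Fixpoint mpoly (K : comNzRingType) (n : nat) : comNzRingType :=
  if n is m.+1 then ({poly (mpoly K m)} : comNzRingType) else K.

Fixpoint mconst (K : comNzRingType) (n : nat) : K -> mpoly K n :=
  if n is m.+1 return K -> mpoly K n
  then fun c => ((mconst m c) %:P : {poly (mpoly K m)}) else fun c => c.

(* the variable x_i (for i < n; 0 otherwise) *)
Fixpoint mvar (K : comNzRingType) (n : nat) : nat -> mpoly K n :=
  if n is m.+1 return nat -> mpoly K n
  then fun i => if i == m then ('X : {poly (mpoly K m)})
                else ((mvar K m i) %:P : {poly (mpoly K m)})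
  else fun _ => 0.

Section Koszul.
Variables (K : comNzRingType) (n : nat).
Local Notation S := (mpoly K n).
Local Notation x i := (mvar K n (nat_of_ord i)).

Definition inIn (f : S) : Prop :=
  exists g : 'I_n -> S, f = \sum_(i < n) g i * x i.

(* flatness of S as an S-module via phi (r . m = phi r * m), stated through
   the equational criterion for flatness (no tensor products available). *)
Definition flat_endo (phi : S -> S) : Prop :=
  forall (k : nat) (a m : 'I_k -> S),
    \sum_(j < k) phi (a j) * m j = 0 ->
    exists (p : nat) (b : 'I_p -> 'I_k -> S) (y : 'I_p -> S),
      (forall j, m j = \sum_(i < p) phi (b i j) * y i) /\
      (forall i, \sum_(j < k) a j * b i j = 0).

Variable phi : S -> S.

(* The left skew polynomial ring S[Theta; phi]: its elements are represented
   by {poly S} (sum_i a_i Theta^i, coefficients on the left), with the skew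
   multiplication (a Theta^i)(b Theta^j) = a phi^i(b) Theta^(i+j). *)
Definition skmul (p q : {poly S}) : {poly S} :=
  \sum_(i < size p) \sum_(j < size q)
     (p`_i * iter i phi q`_j)%:P * 'X^(i + j).

(* action of S[Theta;phi] on S (descends to S/I_n): Theta acts by phi *)
Definition skact (p : {poly S}) (m : S) : S :=
  \sum_(i < size p) p`_i * iter i phi m.

(* Basis of the whole complex (all degrees together): (I, false) stands for
   e_I and (J, true) for e_J /\ u; the homological degree is |I| + b. *)
Definition kidx := ({set 'I_n} * bool)%type.
Definition kdeg (k : kidx) : nat := #|k.1| + k.2.
Definition kvec := {ffun kidx -> {poly S}}.

Definition bvec (k : kidx) : kvec := [ffun k' => if k' == k then 1 else 0].
Definition kscale (a : {poly S}) (v : kvec) : kvec := [ffun k => skmul a (v k)].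

Definition ksign (i : 'I_n) (I : {set 'I_n}) : S :=
  (-1) ^+ #|[set j in I | (j < i)%N]|.

Variable s : 'I_n -> S.
Definition sJ (J : {set 'I_n}) : S := \prod_(j in J) s j.

Definition dbasis (k : kidx) : kvec :=
  let: (A, b) := k in
  if ~~ b then
    \sum_(i in A) kscale (ksign i A * x i)%:P (bvec (A :\ i, false))
  else
    kscale ((-1) ^+ #|A| * ('X - (sJ A)%:P)) (bvec (A, false))
    + \sum_(j in A) kscale (ksign j A * phi (x j))%:P (bvec (A :\ j, true)).

Definition kbound (c : kvec) : kvec := \sum_(k : kidx) kscale (c k) (dbasis k).

Definition khomog (l : nat) (c : kvec) : Prop :=
  forall k, c k != 0 -> kdeg k = l.

Definition kzero (p : {poly S}) : kvec :=
  [ffun k => if k == (set0, false) then p else 0].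

End Koszul.

(* Main.v *)
(* As a right S-module S[Theta; phi] is the sum of the S Theta^m, on which x
   acts as phi^m(x).  The complex is thus the cone of the map given by the
   Theta - s_J from (+)_m Kos(phi^(m+1)(x_j)) to (+)_m Kos(phi^m(x_j)).
   Flatness makes every sequence (phi^m(x_j))_j (weakly) regular, so both
   Koszul complexes have homology in degree 0 only.  On H_0 the map is right
   multiplication by Theta - 1 from (+)_m S/phi^(m+1)(I_n) to
   (+)_m S/phi^m(I_n); it is injective, by descending induction on m, with
   cokernel S/I_n given by the sum of the coefficients. *)
Require Import Defs.
From HB Require Import structures.
From mathcomp Require Import all_boot all_order all_algebra.
From mathcomp Require Import ring.
Set Implicit Arguments. Unset Strict Implicit. Unset Printing Implicit Defensive.
Import GRing.Theory.
Local Open Scope ring_scope.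

(** * Weakly regular sequences and their images under flat maps *)

Definition in_span (R : comNzRingType) (k : nat) (y : nat -> R) (a : R) : Prop :=
  exists h : nat -> R, a = \sum_(j < k) h j * y j.

Definition regular_seq (R : comNzRingType) (n : nat) (y : nat -> R) : Prop :=
  forall k, (k < n)%N -> forall a : R, in_span k y (y k * a) -> in_span k y a.

Section Span.
Variables (R : comNzRingType) (k : nat) (y : nat -> R).

Lemma in_span0 : in_span k y 0.
Proof. by exists (fun=> 0); rewrite big1 // => j _; rewrite mul0r. Qed.

Lemma in_spanD a b : in_span k y a -> in_span k y b -> in_span k y (a + b).
Proof.
move=> [f ->] [g ->]; exists (fun j => f j + g j).
by rewrite -big_split; apply: eq_bigr => j _; rewrite mulrDl.
Qed.

Lemma in_span_sum (I : Type) (r : seq I) (P : pred I) (F : I -> R) :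
  (forall i, P i -> in_span k y (F i)) -> in_span k y (\sum_(i <- r | P i) F i).
Proof. by move=> FP; apply: big_ind => //; [apply: in_span0|apply: in_spanD]. Qed.

Lemma in_spanM (j : 'I_k) a : in_span k y (a * y j).
Proof.
exists (fun i => if i == j :> nat then a else 0); rewrite (bigD1 j) //= eqxx.
by rewrite big1 ?addr0 // => i /negbTE; rewrite -val_eqE /= => ->; rewrite mul0r.
Qed.

Lemma in_span_trans (z : nat -> R) a :
  (forall j : 'I_k, exists t, z j = t * y j) -> in_span k z a -> in_span k y a.
Proof.
move=> zy [h ->]; apply: in_span_sum => j _.
by have [t ->] := zy j; rewrite mulrA; apply: in_spanM.
Qed.
End Span.

(** Regularity of the constants is checked coefficientwise, and ['X] is a nonzerodivisor modulo an
    ideal generated by constants. The new variable comes last, as in [mvar]. *)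
Lemma poly_regular (R : comNzRingType) (n : nat) (y : nat -> R) :
  regular_seq n y ->
  regular_seq n.+1 (fun i => if i == n then 'X : {poly R} else (y i)%:P).
Proof.
move=> regy k; rewrite ltnS => lekn a [g].
have cE (h : nat -> {poly R}) : \sum_(j < k) h j *
    (if j == n :> nat then 'X : {poly R} else (y j)%:P) =
    \sum_(j < k) h j * (y j)%:P.
  by apply: eq_bigr => j _; rewrite ltn_eqF // (leq_trans (ltn_ord j)).
rewrite cE; case: eqP => [_|/eqP nk] eqa.
  exists (fun j => drop_poly 1 (g j)); rewrite (cE (fun j => drop_poly 1 (g j))); apply/polyP => i.
  have /(congr1 (fun p : {poly R} => p`_i.+1)) := eqa.
  rewrite coefXM /= => ->; rewrite !coef_sum; apply: eq_bigr => j _.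
  by rewrite !coefMC coef_drop_poly addn1.
have ltkn : (k < n)%N by rewrite ltn_neqAle nk.
have /fin_all_exists[h hP] (i : 'I_(size a)) :
    exists h : nat -> R, a`_i = \sum_(j < k) h j * y j.
  have /(congr1 (fun p : {poly R} => p`_i)) := eqa.
  rewrite coefCM coef_sum => eqi.
  apply: (regy k ltkn); exists (fun j => (g j)`_i).
  by rewrite eqi; apply: eq_bigr => j _; rewrite coefMC.
pose h' (j : nat) := \sum_(i < size a) (h i j)%:P * 'X^i.
exists h'; rewrite (cE h') -[a in LHS]coefK poly_def.
under [RHS]eq_bigr do rewrite big_distrl.
rewrite exchange_big; apply: eq_bigr => i _ /=.
rewrite hP -mul_polyC rmorph_sum big_distrl; apply: eq_bigr => j _ /=.
by rewrite rmorphM; ring.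
Qed.

Lemma mvar_regular (K : comNzRingType) (n : nat) : regular_seq n (mvar K n).
Proof. by elim: n => [//|n /poly_regular]. Qed.

(** By flatness a relation among the [phi (y j)] is a combination of images of relations among the
    [y j]; regularity puts the last entries [b i ord_max] of the latter in the span of the earlier
    [y j]. *)
Lemma flat_regular (K : comNzRingType) (n m : nat)
    (phi : {rmorphism mpoly K n -> mpoly K n}) (y : nat -> mpoly K n) :
  flat_endo phi -> regular_seq m y -> regular_seq m (fun i => phi (y i)).
Proof.
move=> flat regy k ltkm a [g eqa].
have [|p [b [z [mE relb]]]] := flat k.+1 (fun j => y j)
    (fun j : 'I_k.+1 => if (j < k)%N then g j else - a).
  rewrite big_ord_recr /= ltnn mulrN eqa.
  by under eq_bigr => j _ do rewrite /= ltn_ord mulrC; rewrite subrr.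
have /fin_all_exists[h hP] (i : 'I_p) :
    exists h : nat -> mpoly K n, b i ord_max = \sum_(j < k) h j * y j.
  apply: (regy k ltkm); exists (fun j => - b i (inord j)).
  have := relb i; rewrite big_ord_recr /= addrC => /eqP; rewrite addr_eq0 => /eqP->.
  rewrite -sumrN; apply: eq_bigr => j _; rewrite mulrC mulNr.
  by congr (- (b i _ * _)); apply: val_inj; rewrite /= inordK // ltnS ltnW.
exists (fun j => - \sum_(i < p) phi (h i j) * z i).
have := mE ord_max; rewrite /= ltnn => /eqP; rewrite eqr_oppLR => /eqP->.
under eq_bigr => i _ do rewrite hP rmorph_sum big_distrl.
under [RHS]eq_bigr do rewrite mulNr big_distrl.
rewrite sumrN; congr (- _).
rewrite exchange_big; apply: eq_bigr => j _; apply: eq_bigr => i _ /=.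
by rewrite rmorphM; ring.
Qed.

Lemma iter_flat_regular (K : comNzRingType) (n m : nat)
    (phi : {rmorphism mpoly K n -> mpoly K n}) (y : nat -> mpoly K n) i :
  flat_endo phi -> regular_seq m y -> regular_seq m (fun j => iter i phi (y j)).
Proof. by move=> flat regy; elim: i => [//|i] /(flat_regular flat). Qed.

(** * Exactness of the Koszul complex of a regular sequence *)

Section Koszul.
Variables (R : comNzRingType) (n : nat).
Implicit Types (y : nat -> R) (v w : {set 'I_n} -> R) (A B : {set 'I_n}).

Definition below (i : 'I_n) (A : {set 'I_n}) := #|[set j in A | (j < i)%N]|.

(** Coefficient at e_B of the Koszul differential of the sum of the [v A] e_A, all degrees at once:
    e_B arises from the sets [j |: B], and [j] does not count in its own sign. *)
Definition kosd (y : nat -> R) (v : {set 'I_n} -> R) (B : {set 'I_n}) : R :=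
  \sum_(j | j \notin B) (-1) ^+ below j B * (v (j |: B) * y j).

Lemma setU1_neq0 (j : 'I_n) B : j |: B != set0.
Proof. by apply/set0Pn; exists j; rewrite setU11. Qed.

Lemma eq_kosd y v w B :
  (forall A, A != set0 -> v A = w A) -> kosd y v B = kosd y w B.
Proof. by move=> vw; apply: eq_bigr => j _; rewrite vw ?setU1_neq0. Qed.

Lemma kosdD y v w B : kosd y (fun A => v A + w A) B = kosd y v B + kosd y w B.
Proof. by rewrite -big_split; apply: eq_bigr => j _; rewrite /= mulrDl mulrDr. Qed.

Lemma kosdB y v w B : kosd y (fun A => v A - w A) B = kosd y v B - kosd y w B.
Proof. by rewrite -sumrB; apply: eq_bigr => j _; rewrite mulrBl mulrBr. Qed.

Lemma kosdN y v B : kosd y (fun A => - v A) B = - kosd y v B.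
Proof. by rewrite -sumrN; apply: eq_bigr => j _; rewrite mulNr mulrN. Qed.

Lemma kosd_eq0 y v B :
  (forall j, j \notin B -> v (j |: B) = 0) -> kosd y v B = 0.
Proof. by move=> v0; apply: big1 => j /v0->; rewrite mul0r mulr0. Qed.

Lemma kosd_set0 y v : kosd y v set0 = \sum_j v [set j] * y j.
Proof.
apply: eq_big => [j|j _]; first by rewrite inE.
rewrite setU0 /below (_ : [set _ in _ | _] = set0) ?cards0 ?mul1r //.
by apply/setP=> i; rewrite !inE.
Qed.

Lemma belowU1 i j B : j \notin B -> below i (j |: B) = ((j < i) + below i B)%N.
Proof.
move=> jB; have [ji|ij] := boolP (j < i)%N.
  rewrite /below (_ : [set _ in _ | _] = j |: [set k in B | (k < i)%N]).
    by rewrite cardsU1 !inE (negbTE jB).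
  by apply/setP=> k; rewrite !inE; case: eqP => // ->.
rewrite add0n; apply: eq_card => k; rewrite !inE.
by case: eqP => //= ->; rewrite (negbTE ij) andbF.
Qed.

(** Removing [i] and [j] in the two orders gives opposite signs, so the terms with [i < j] cancel
    the others. *)
Lemma kosd_kosd y v B : kosd y (kosd y v) B = 0.
Proof.
pose F (i j : 'I_n) : R := (-1) ^+ below j B * ((-1) ^+ (j < i)%N *
  (-1) ^+ below i B * (v (i |: (j |: B)) * y i) * y j).
have -> : kosd y (kosd y v) B =
    \sum_(j | j \notin B) \sum_(i | (i \notin B) && (i != j)) F i j.
  apply: eq_bigr => j jB; rewrite big_distrl big_distrr /=.
  apply: eq_big => [i|i]; first by rewrite !inE negb_or andbC.
  by rewrite /F belowU1 // exprD.
under eq_bigr => j _ do rewrite (bigID (fun i : 'I_n => (i < j)%N)) /=.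
rewrite big_split /= [X in _ + X](exchange_big_dep (fun i => i \notin B)) /=;
  last by move=> j i _ /andP[/andP[]].
rewrite -big_split big1 // => j jB; rewrite /= addrC.
rewrite (eq_bigl (fun i : 'I_n => [&& i \notin B, i != j & (i < j)%N])); last first.
  move=> i; rewrite jB /= -leqNgt -!val_eqE /=; case: (i \notin B) => //=.
  by case: ltngtP.
rewrite [X in _ + X](eq_bigl (fun i : 'I_n => [&& i \notin B, i != j & (i < j)%N])); last first.
  by move=> i; rewrite andbA.
rewrite -big_split big1 // => i /and3P[_ _ ltij] /=.
rewrite /F ltij ltnNge (ltnW ltij) /= setUCA expr1 expr0; ring.
Qed.

Lemma kosd_set0_span y v : in_span n y (kosd y v set0).
Proof. by rewrite kosd_set0; apply: in_span_sum => j _; apply: in_spanM. Qed.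

(** Multiplication by [t] is a chain map from the complex of [y'] to that of [y], and the sign
    anticommutes with the differential. Later [t] is phi^m(s_A). *)
Lemma kosd_twist y y' (t : {set 'I_n} -> R) v w B :
  (forall j, j \notin B -> t (j |: B) * y j = t B * y' j) ->
  kosd y (fun A => (-1) ^+ #|A| * (v A - w A * t A)) B =
  - ((-1) ^+ #|B| * (kosd y v B - kosd y' w B * t B)).
Proof.
move=> ty; rewrite /kosd big_distrl -sumrB big_distrr -sumrN.
apply: eq_bigr => j jB /=; rewrite cardsU1 jB exprS.
have -> : (-1) ^+ below j B * (w (j |: B) * y' j) * t B =
          (-1) ^+ below j B * w (j |: B) * (t (j |: B) * y j).
  by rewrite ty //; ring.
by ring.
Qed.

(* Induction on [k], splitting [v] as [v' + e_k /\ v1] and lifting [v1] first;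
   regularity handles the degree-zero part of [v1], whose multiple by [y k]
   is a combination of the earlier [y j]. *)
Lemma regular_koszul_exact_below y k : (k <= n)%N -> regular_seq n y ->
  forall v, (forall A (i : 'I_n), i \in A -> (k <= i)%N -> v A = 0) ->
  (forall B, kosd y v B = 0) -> in_span k y (v set0) ->
  exists w : {set 'I_n} -> R,
    (forall A (i : 'I_n), i \in A -> (k <= i)%N -> w A = 0) /\
    (forall B, kosd y w B = v B).
Proof.
move=> lekn regy; elim: k lekn => [|k IHk] ltkn v vlt dv [h v0].
  exists (fun=> 0); split=> // B; rewrite kosd_eq0 //.
  have [->|/set0Pn[i iB]] := eqVneq B set0; last by rewrite (vlt _ i).
  by rewrite v0 big_ord0.
pose K := Ordinal ltkn.
have {}IHk := IHk (ltnW ltkn).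
pose v1 B := if K \in B then 0 else v (K |: B).
have v1lt A (i : 'I_n) : i \in A -> (k <= i)%N -> v1 A = 0.
  rewrite /v1; case: ifP => // KA iA; rewrite leq_eqVlt => /orP[/eqP ki|ki].
    by rewrite (_ : K = i) ?iA // in KA; apply: val_inj.
  by rewrite (vlt _ i) // !inE iA orbT.
have dv1 B : kosd y v1 B = 0.
  have [KB|KB] := boolP (K \in B).
    by apply: kosd_eq0 => j _; rewrite (v1lt _ K) // !inE KB orbT.
  rewrite -(dv (K |: B)) [LHS](bigD1 K) //= {1}/v1 setU11 mul0r mulr0 add0r.
  apply: eq_big => [j|j /andP[jB jK]]; first by rewrite !inE negb_or andbC.
  (* [K] is the largest index in use, so a sign that adjoining it changes sits on a zero term. *)
  rewrite belowU1 // exprD /v1 !inE (eq_sym K) (negbTE jK) (negbTE KB) /= setUCA.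
  case: ltnP => [kj|_]; last by rewrite mul1r.
  by rewrite (vlt _ j) ?mul0r ?mulr0 // !inE eqxx.
have v10 : in_span k y (v1 set0).
  (* The component of [dv] at [set0] expresses [v [set K] * y k] through the earlier [y j]. *)
  pose g (j : nat) := if insub j is Some i then - v [set i] else 0.
  apply: (regy k ltkn); exists g.
  rewrite (big_ord_widen n (fun j => g j * y j) (ltnW ltkn)).
  have := dv set0; rewrite kosd_set0 (bigD1 K) //= /v1 inE setU0 mulrC.
  move/eqP; rewrite addr_eq0 => /eqP->; rewrite -sumrN big_mkcond [RHS]big_mkcond.
  apply: eq_bigr => j _; rewrite /g valK mulNr -val_eqE /=.
  by case: ltngtP => // kj; rewrite (vlt _ j) ?inE // mul0r oppr0.
have [w1 [w1lt dw1]] := IHk _ v1lt dv1 v10.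
(* [w1] with e_K adjoined, except for the entry at [[set K]]: components of [kosd y z] at sets
   containing [K] do not see it, and [h k] cancels the last term of [v set0]. *)
pose z A := if A == [set K] then h k else if K \in A then w1 (A :\ K) else 0.
have zlt A (i : 'I_n) : i \in A -> (k < i)%N -> z A = 0.
  move=> iA ki; have iK : i != K by rewrite -val_eqE /= gtn_eqF.
  rewrite /z; case: eqP iA => [->|_ iA]; first by rewrite inE (negbTE iK).
  by case: ifP => // _; rewrite (w1lt _ i) ?inE ?iK // ltnW.
have dz B : K \in B -> kosd y z B = v B.
  move=> KB; have -> : v B = kosd y w1 (B :\ K).
    by rewrite dw1 /v1 !inE eqxx setD1K.
  rewrite [RHS](bigD1 K) ?setD11 //= setD1K // (w1lt _ K) // mul0r mulr0 add0r.
  apply: eq_big => [j|j jB].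
    by rewrite !inE; case: eqP => [->|] /=; rewrite ?KB ?andbF ?andbT.
  have jK : j != K by apply: contraNneq jB => ->.
  rewrite -{1}(setD1K KB) belowU1 ?setD11 // exprD /z !inE KB orbT /=.
  rewrite ifN; last by apply: contraNneq jK => jBK; rewrite -in_set1 -jBK setU11.
  rewrite (_ : (j |: B) :\ K = j |: B :\ K); last first.
    by apply/setP=> i; rewrite !inE; case: (eqVneq i j) => [->|] //=; rewrite jK.
  case: ltnP => [kj|_]; last by rewrite mul1r.
  by rewrite (w1lt _ j) ?mul0r ?mulr0 // ?setU11 // ltnW.
(* Subtracting the boundary of [z] leaves only indices below [k]. *)
have [||/=|w [wlt dw]] := IHk (fun A => v A - kosd y z A).
- move=> A i iA; rewrite leq_eqVlt => /orP[/eqP ki|ki].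
    by rewrite dz ?subrr // (_ : K = i) //; apply: val_inj.
  rewrite (vlt _ i) // kosd_eq0 ?subr0 // => j _.
  by rewrite (zlt _ i) // !inE iA orbT.
- by move=> B; rewrite kosdB dv kosd_kosd subr0.
- exists h; rewrite v0 kosd_set0 (bigD1 K) //= {1}/z eqxx big_ord_recr /=.
  rewrite [X in _ - (_ + X)]big1 ?addr0 ?addrK // => j jK.
  by rewrite /z (inj_eq set1_inj) inE (eq_sym K) (negbTE jK) mul0r.
exists (fun A => w A + z A); split=> [A i iA ki|B].
  by rewrite (wlt _ i) ?(zlt _ i) ?addr0 // ltnW.
by rewrite kosdD dw subrK.
Qed.

Lemma regular_koszul_exact y v : regular_seq n y ->
  (forall B, kosd y v B = 0) -> in_span n y (v set0) ->
  exists w : {set 'I_n} -> R, w set0 = 0 /\ forall B, kosd y w B = v B.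
Proof.
move=> regy dv v0.
have [|w [_ dw]] := regular_koszul_exact_below (leqnn n) regy _ dv v0.
  by move=> A i; rewrite leqNgt ltn_ord.
(* The entry at [set0] never enters [kosd], so it can be reset to 0. *)
exists (fun A => if A == set0 then 0 else w A); rewrite eqxx; split=> // B.
by rewrite -dw; apply: eq_kosd => A /negbTE->.
Qed.

Lemma poly_koszul_exact (y : nat -> nat -> R) (v : {set 'I_n} -> {poly R}) :
  (forall m, regular_seq n (y m)) ->
  (forall m B, kosd (y m) (fun A => (v A)`_m) B = 0) ->
  (forall m, in_span n (y m) (v set0)`_m) ->
  exists w : {set 'I_n} -> {poly R}, w set0 = 0 /\
    forall m B, kosd (y m) (fun A => (w A)`_m) B = (v B)`_m.
Proof.
move=> regy dv v0; pose N := \max_B size (v B).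
have /fin_all_exists[w wP] (m : 'I_N) := regular_koszul_exact (regy m) (dv m) (v0 m).
(* From [N] on all coefficients of [v] vanish and 0 is a lift, so the coefficientwise lifts form
   polynomials. *)
exists (fun A => \poly_(m < N) (if insub m is Some i then w i A else 0)); split.
  apply/polyP => m; rewrite coef_poly coef0; case: ltnP => // ltmN.
  by rewrite insubT; have [->] := wP (Ordinal ltmN).
move=> m B; have [ltmN|leNm] := ltnP m N.
  have [_ <-] := wP (Ordinal ltmN); apply: eq_kosd => A _.
  by rewrite coef_poly ltmN insubT.
rewrite kosd_eq0 => [|j _]; last by rewrite coef_poly ltnNge leNm.
rewrite nth_default //; apply: leq_trans leNm.
exact: (leq_bigmax (F := fun A => size (v A))).
Qed.
End Koszul.

(** * Coefficients of skew products *)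

Section Skew.
Variables (K : comNzRingType) (n : nat).
Local Notation S := (mpoly K n).
Variable phi : {rmorphism S -> S}.

Lemma iter_rmorphism i : exists f : {rmorphism S -> S}, f =1 iter i phi.
Proof.
elim: i => [|i [f fE]]; first by exists idfun.
by exists (phi \o f) => a; rewrite /= fE.
Qed.

(** Convolution form, free of the sizes of [p] and [q]: terms beyond them vanish since the iterates
    of [phi] fix 0. *)
Lemma coef_skmul (p q : {poly S}) m :
  (skmul phi p q)`_m = \sum_(i < m.+1) p`_i * iter i phi q`_(m - i).
Proof.
have iter0 i : iter i phi 0 = 0 by have [f <-] := iter_rmorphism i; rewrite rmorph0.
pose F i := if (i <= m)%N then p`_i * iter i phi q`_(m - i) else 0.
have -> : (skmul phi p q)`_m = \sum_(i < size p) F i.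
  rewrite coef_sum; apply: eq_bigr => i _; rewrite coef_sum.
  under eq_bigr do rewrite coefCM coefXn.
  rewrite /F; case: leqP => [leim|ltmi]; last first.
    by rewrite big1 // => j _; rewrite ltn_eqF ?mulr0 // ltn_addr.
  have [ltmq|leqm] := ltnP (m - i) (size q); last first.
    rewrite (nth_default _ leqm) iter0 mulr0 big1 // => j _.
    rewrite gtn_eqF ?mulr0 // -(subnKC leim) ltn_add2l.
    exact: leq_trans leqm.
  rewrite (bigD1 (Ordinal ltmq)) //= subnKC // eqxx mulr1 big1 ?addr0 // => j.
  rewrite -val_eqE /= => jm; case: eqP => [mE|_]; last by rewrite mulr0.
  by rewrite mE addKn eqxx in jm.
rewrite (big_ord_widen (maxn (size p) m.+1)) ?leq_maxl //.
rewrite [RHS](big_ord_widen (maxn (size p) m.+1)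
  (fun i => p`_i * iter i phi q`_(m - i))) ?leq_maxr //.
rewrite big_mkcond [RHS]big_mkcond; apply: eq_bigr => i _; rewrite /F ltnS.
by case: ltnP => // lepi; case: ifP => // _; rewrite nth_default // mul0r.
Qed.

Lemma coef_skmulC p a m : (skmul phi p a%:P)`_m = p`_m * iter m phi a.
Proof.
have iter0 i : iter i phi 0 = 0 by have [f <-] := iter_rmorphism i; rewrite rmorph0.
rewrite coef_skmul big_ord_recr /= subnn coefC eqxx big1 ?add0r // => i _.
by rewrite coefC subn_eq0 leqNgt ltn_ord /= iter0 mulr0.
Qed.

Lemma skmulDr p q r : skmul phi p (q + r) = skmul phi p q + skmul phi p r.
Proof.
apply/polyP => m; rewrite coefD !coef_skmul -big_split; apply: eq_bigr => i _.
by have [f fE] := iter_rmorphism i; rewrite -!fE coefD rmorphD mulrDr.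
Qed.

Lemma skmul0 p : skmul phi p 0 = 0.
Proof. by apply: (addrI (skmul phi p 0)); rewrite -skmulDr !addr0. Qed.

Lemma skmul1 p : skmul phi p 1 = p.
Proof.
apply/polyP => m; rewrite coef_skmulC.
by have [f <-] := iter_rmorphism m; rewrite rmorph1 mulr1.
Qed.

Lemma skmul_sum (I : Type) (r : seq I) (P : pred I) p (F : I -> {poly S}) :
  skmul phi p (\sum_(i <- r | P i) F i) = \sum_(i <- r | P i) skmul phi p (F i).
Proof. by apply: (big_morph _ (skmulDr p)); apply: skmul0. Qed.

(** The coefficients of Theta are 0 and 1, fixed by [phi], so right multiplication by Theta is the
    ordinary shift. *)
Lemma coef_skmulX p m : (skmul phi p 'X)`_m = (p * 'X)`_m.
Proof.
case: m => [|m]; rewrite coef_skmul coefMX /=.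
  by rewrite big_ord1 coefX /= mulr0.
have iterE i (b : bool) : iter i phi b%:R = b%:R.
  by have [f <-] := iter_rmorphism i; rewrite rmorph_nat.
rewrite big_ord_recr big_ord_recr /= subSnn subnn !coefX !iterE rmorph_nat !mulr_natr mulr1n mulr0n addr0.
rewrite big1 ?add0r // => i _; rewrite coefX subSn 1?ltnW ?ltn_ord // eqSS subn_eq0 leqNgt ltn_ord.
by rewrite iterE mulr0.
Qed.
End Skew.

(** * The differential as that of a cone *)

Section Complex.
Variables (K : comNzRingType) (n : nat).
Local Notation S := (mpoly K n).
Variables (phi : {rmorphism S -> S}) (s : 'I_n -> S).
Implicit Types (c d : kvec K n) (A B : {set 'I_n}).

Let y m (j : nat) : S := iter m phi (mvar K n j).

Lemma sum_kidx (V : nmodType) (F : kidx n -> V) :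
  \sum_k F k = \sum_A F (A, false) + \sum_A F (A, true).
Proof.
have -> : \sum_k F k = \sum_k F (k.1, k.2) by apply: eq_bigr => -[].
rewrite -(pair_bigA _ (fun A b => F (A, b))) -big_split /=.
by apply: eq_bigr => A _; rewrite big_bool addrC.
Qed.

Lemma sum_setD1 (V : nmodType) (F : {set 'I_n} -> 'I_n -> V) B :
  \sum_(A : {set 'I_n}) \sum_(i in A) (if A :\ i == B then F A i else 0) =
  \sum_(i | i \notin B) F (i |: B) i.
Proof.
rewrite (exchange_big_dep predT) //= [RHS]big_mkcond; apply: eq_bigr => i _.
rewrite -big_mkcondr; case: ifPn => iB.
  rewrite (big_pred1 (i |: B)) // => A /=; apply/andP/eqP => [[iA /eqP<-]|->].
    by rewrite setD1K.
  by rewrite setU11 setU1K.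
rewrite big_pred0 // => A; apply/andP => -[iA /eqP BE].
by rewrite -BE setD11 in iB.
Qed.

Lemma kbound_ffunE c k :
  kbound phi s c k = \sum_k' skmul phi (c k') (dbasis phi s k' k).
Proof. by rewrite sum_ffunE; apply: eq_bigr => k' _; rewrite ffunE. Qed.

Lemma kscale_bvec p (k k' : kidx n) :
  kscale phi p (bvec K k) k' = if k' == k then p else 0.
Proof. by rewrite !ffunE; case: eqP => _; rewrite ?skmul1 ?skmul0. Qed.

(** Right multiplication by a scalar acts on the coefficient of Theta^m through phi^m, which fixes
    signs. *)
Lemma coef_kbound_sum c (b : bool) (a : nat -> S) m B :
  (\sum_(A : {set 'I_n}) skmul phi (c (A, b)) (\sum_(i in A)
     kscale phi (ksign K i A * a i)%:P (bvec K (A :\ i, b)) (B, b)))`_m =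
  kosd (fun j => iter m phi (a j)) (fun A => (c (A, b))`_m) B.
Proof.
under eq_bigr => A _ do rewrite skmul_sum.
rewrite coef_sum.
under eq_bigr => A _.
  rewrite coef_sum.
  under eq_bigr => i iA.
    rewrite kscale_bvec xpair_eqE eqxx andbT eq_sym (fun_if (skmul phi _)) skmul0.
    rewrite (fun_if (fun p : {poly S} => p`_m)) coef_skmulC coef0.
    over.
  over.
rewrite (sum_setD1 (fun A i => (c (A, b))`_m * iter m phi (ksign K i A * a i))).
apply: eq_bigr => i iB; have [f fE] := iter_rmorphism phi m.
rewrite -!fE rmorphM rmorphXn rmorphN rmorph1 /ksign -/(below i (i |: B)).
by rewrite belowU1 // ltnn add0n mulrCA.
Qed.

(** The index is [m.+1] because the [u] half carries phi(x_j). *)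
Lemma kbound_true c m B :
  (kbound phi s c (B, true))`_m = kosd (y m.+1) (fun A => (c (A, true))`_m) B.
Proof.
rewrite kbound_ffunE sum_kidx big1 ?add0r => [|A _]; last first.
  rewrite /dbasis /= sum_ffunE big1 ?skmul0 // => i _.
  by rewrite kscale_bvec xpair_eqE andbF.
under eq_bigr => A _ do
  rewrite /dbasis /= ffunE kscale_bvec xpair_eqE andbF add0r sum_ffunE.
rewrite (coef_kbound_sum c true (fun j => phi (mvar K n j))).
by apply: eq_bigr => i _; rewrite /y iterSr.
Qed.

Lemma kbound_false c m B :
  (kbound phi s c (B, false))`_m =
    kosd (y m) (fun A => (c (A, false))`_m) B
    + (-1) ^+ #|B| * ((c (B, true) * 'X)`_m - (c (B, true))`_m * iter m phi (sJ s B)).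
Proof.
rewrite kbound_ffunE sum_kidx coefD; congr (_ + _).
  under eq_bigr => A _ do rewrite /dbasis /= sum_ffunE.
  exact: (coef_kbound_sum c false (mvar K n)).
rewrite (bigD1 B) //= [X in _ + X]big1 ?addr0 => [|A AB]; last first.
  rewrite ffunE kscale_bvec xpair_eqE eq_sym (negbTE AB) add0r sum_ffunE.
  by rewrite big1 ?skmul0 // => i _; rewrite kscale_bvec xpair_eqE andbF.
rewrite ffunE kscale_bvec xpair_eqE !eqxx sum_ffunE [X in _ + X]big1 ?addr0; last first.
  by move=> i _; rewrite kscale_bvec xpair_eqE andbF.
have -> : (-1) ^+ #|B| * ('X - (sJ s B)%:P) =
    (if odd #|B| then - ('X - (sJ s B)%:P) else 'X - (sJ s B)%:P) :> {poly S}.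
  by rewrite -signr_odd mulr_sign.
have skN p q : skmul phi p (- q) = - skmul phi p q.
  by apply: (addrI (skmul phi p q)); rewrite -skmulDr !subrr skmul0.
rewrite (fun_if (skmul phi _)) skN skmulDr skN.
rewrite (fun_if (fun p : {poly S} => p`_m)) coefN coefB coef_skmulC coef_skmulX.
by rewrite -signr_odd mulr_sign.
Qed.

(** Component of degree [l]: exactness is proved for all degrees together and cut down
    afterwards. *)
Definition ktrunc (l : nat) c : kvec K n := [ffun k => if kdeg k == l then c k else 0].

Lemma khomog_trunc l c : khomog l (ktrunc l c).
Proof. by move=> k; rewrite ffunE; case: ifP => [/eqP|_ /eqP]. Qed.

Lemma kbound_trunc l c : kbound phi s (ktrunc l.+1 c) = ktrunc l (kbound phi s c).
Proof.
have kosd_trunc z b m B : kosd z (fun A => (ktrunc l.+1 c (A, b))`_m) B =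
    if kdeg (B, b) == l then kosd z (fun A => (c (A, b))`_m) B else 0.
  have dE j : j \notin B -> (kdeg (j |: B, b) == l.+1) = (kdeg (B, b) == l).
    by move=> jB; rewrite /kdeg cardsU1 jB.
  case: ifP => kl; last first.
    by apply: kosd_eq0 => j jB; rewrite ffunE dE // kl coef0.
  by apply: eq_bigr => j jB; rewrite ffunE dE // kl.
apply/ffunP => -[B [] ]; apply/polyP => m; rewrite [in RHS]ffunE.
  rewrite kbound_true kosd_trunc; case: ifP => kl; last by rewrite coef0.
  by rewrite kbound_true.
rewrite kbound_false kosd_trunc ffunE.
have -> : (kdeg (B, true) == l.+1) = (kdeg (B, false) == l).
  by rewrite /kdeg addn1 addn0.
case: ifP => _; first by rewrite kbound_false.
by rewrite mul0r coef0 mul0r subr0 mulr0 addr0.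
Qed.

(** * Exactness, and the image in degree zero *)

Hypothesis phi_flat : flat_endo phi.
Hypothesis phi_x : forall i : 'I_n, phi (mvar K n i) = s i * mvar K n i.

Lemma y_regular m : regular_seq n (y m).
Proof. exact: iter_flat_regular phi_flat (@mvar_regular K n). Qed.

Lemma yS m (j : 'I_n) : y m.+1 j = iter m phi (s j) * y m j.
Proof.
have [f fE] := iter_rmorphism phi m.
by rewrite /y iterSr phi_x -!fE rmorphM.
Qed.

(** Each phi^(m+1)(x_j) is a multiple of phi^m(x_j), so the ideals decrease with [m]. *)
Lemma span_yS m a : in_span n (y m.+1) a -> in_span n (y m) a.
Proof. by apply: in_span_trans => j; rewrite yS; exists (iter m phi (s j)). Qed.

Lemma span_y0 m a : in_span n (y m) a -> in_span n (mvar K n) a.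
Proof. by elim: m => [//|m IHm] /span_yS/IHm. Qed.

Lemma kbound_false0 c m :
  (kbound phi s c (set0, false))`_m =
    kosd (y m) (fun A => (c (A, false))`_m) set0
    + (c (set0, true) * 'X)`_m - (c (set0, true))`_m.
Proof.
rewrite kbound_false cards0 mul1r /sJ big_set0.
by have [f <-] := iter_rmorphism phi m; rewrite rmorph1 mulr1 addrA.
Qed.

(* Injectivity of right multiplication by [Theta - 1] from H_0 of the Koszul
   complex of the [phi (x_j)] to that of the [x_j], coefficient by coefficient,
   starting from the top one. *)
Lemma cycle_true_span c : kbound phi s c = 0 ->
  forall m, in_span n (y m.+1) (c (set0, true))`_m.
Proof.
move=> dc m; have [t] := ubnP (size (c (set0, true)) - m).
elim: t m => // t IHt m; rewrite ltnS leq_subLR => lt.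
have := kbound_false0 c m.+1; rewrite dc ffunE coef0 coefMX /=.
set b := _`_m; set b' := _`_m.+1; set e := kosd _ _ _ => eq0.
(* [eq0] reads 0 = e + b - b', the coefficient of Theta^(m+1) at the empty set. *)
have -> : b = b' + (-1) * e by rewrite -[LHS]subr0 [X in _ - X]eq0; ring.
apply: in_spanD.
  have [les|] := leqP (size (c (set0, true))) m.+1.
    by rewrite /b' nth_default //; apply: in_span0.
  move=> ltm; apply: span_yS; apply: IHt.
  by rewrite ltn_subLR ?(ltnW ltm) // addSn ltnS.
rewrite mulN1r -kosdN; exact: kosd_set0_span.
Qed.

(** Diagram chase in the cone: [g] lifts the [u] part of [c]; removing its signed image under the
    Theta - s_J leaves a cycle [e] of the other half, which [f] lifts. *)
Lemma kbound_exact c : kbound phi s c = 0 -> c (set0, false) = 0 ->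
  exists d, kbound phi s d = c.
Proof.
move=> dc c0.
have [||g [g0 dg]] := poly_koszul_exact (fun m => @y_regular m.+1) (v := fun A => c (A, true)).
- by move=> m B; rewrite -kbound_true dc ffunE coef0.
- exact: cycle_true_span.
(* The bound is one more than the size of [g A] because Theta shifts by one. *)
pose e A : {poly S} :=
  c (A, false) - \poly_(m < (size (g A)).+1)
     ((-1) ^+ #|A| * ((g A * 'X)`_m - (g A)`_m * iter m phi (sJ s A))).
have eE A m : (e A)`_m = (c (A, false))`_m -
    (-1) ^+ #|A| * ((g A * 'X)`_m - (g A)`_m * iter m phi (sJ s A)).
  rewrite coefB coef_poly; case: ltnP => // ltm.
  rewrite coefMX; case: m ltm => [//|m ltm] /=.
  have g0m i : (m <= i)%N -> (g A)`_i = 0.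
    by move=> lemi; apply: nth_default; apply: leq_trans lemi.
  by rewrite !g0m // mul0r subrr mulr0.
have [||f [_ df]] := poly_koszul_exact (@y_regular) (v := e).
- move=> m B; under eq_kosd => A _ do rewrite eE.
  rewrite kosdB (@kosd_twist _ _ (y m) (y m.+1)) => [|j jB]; last first.
    rewrite yS /sJ big_setU1 //=; have [f fE] := iter_rmorphism phi m.
    by rewrite -!fE rmorphM /=; ring.
  (* For positive [m], coefficient [m] of [g A * 'X] is coefficient [m - 1] of [g A], where [dg]
     uses the same sequence [y m]. *)
  have -> : kosd (y m) (fun A => (g A * 'X)`_m) B = (c (B, true) * 'X)`_m.
    case: m => [|m]; last first.
      by rewrite coefMX -dg; apply: eq_kosd => A _; rewrite coefMX.
    by rewrite coefMX kosd_eq0 // => j _; rewrite coefMX.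
  by rewrite dg opprK -kbound_false dc ffunE coef0.
(* Both [g] and [c] vanish in degree zero, hence so does [e]. *)
- move=> m; rewrite eE g0 c0 mul0r coef0 mul0r subrr mulr0 subrr; exact: in_span0.
exists [ffun k : kidx n => if k.2 then g k.1 else f k.1].
apply/ffunP => -[B []]; apply/polyP => m.
  by rewrite kbound_true -dg; apply: eq_kosd => A _; rewrite ffunE.
rewrite kbound_false; under eq_kosd => A _ do rewrite ffunE.
by rewrite df eE !ffunE /= subrK.
Qed.

Lemma kbound_image p : in_span n (mvar K n) p.[1] <->
  exists d, khomog 1 d /\ kbound phi s d = kzero p.
Proof.
split=> [[h ph]|[d [_ dE]]]; last first.
  pose b := d (set0, true).
  (* Removing the multiple of Theta - 1 keeps the value at 1 and leaves coefficients in the spans of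
     the [y m], all inside I_n. *)
  have -> : p.[1] = (p - b * 'X + b).[1] by rewrite !hornerE; ring.
  rewrite horner_coef; apply: in_span_sum => m _; rewrite expr1n mulr1.
  have := kbound_false0 d m; rewrite dE ffunE eqxx => pE.
  rewrite coefD coefB pE -/b addrAC subrK addrK; apply: (@span_y0 m); exact: kosd_set0_span.
(* Right multiplication by Theta - 1 is the ordinary one, so the factor theorem supplies the
   coefficient [b] of u. *)
have /factor_theorem[b bE] : root (p - p.[1]%:P) 1.
  by rewrite rootE !hornerE subrr.
pose c : kvec K n := [ffun k : kidx n =>
  if k.2 then b else \sum_(j : 'I_n | k.1 == [set j]) (h j)%:P].
exists (ktrunc 1 c); split; first exact: khomog_trunc.
rewrite kbound_trunc; apply/ffunP => k; rewrite !ffunE.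
have -> : (kdeg k == 0) = (k == (set0, false)).
  by case: k => A [] ; rewrite /kdeg addn_eq0 cards_eq0 xpair_eqE ?andbF ?andbT.
case: eqP => // ->; apply/polyP => m; rewrite kbound_false0 !ffunE /=.
move: bE; rewrite mulrBr mulr1 => bE.
have -> : p`_m = p.[1]%:P`_m + (b * 'X)`_m - b`_m.
  by rewrite -addrA -coefB -bE -coefD subrKC.
congr (_ + _ - _); rewrite kosd_set0 coefC ph.
case: m => [|m] /=; last first.
  rewrite big1 // => j _; rewrite ffunE /= coef_sum big1 ?mul0r // => i _.
  by rewrite coefC.
apply: eq_bigr => j _; rewrite ffunE /= (big_pred1 j) ?coefC // => i.
by rewrite (inj_eq set1_inj) eq_sym.
Qed.
End Complex.

(** * Homology of the complex *)

Theorem theorem3 (K : comNzRingType) (n : nat)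
  (phi : {rmorphism mpoly K n -> mpoly K n})
  (phiK : forall c : K, phi (mconst n c) = mconst n c)
  (phi_flat : flat_endo phi)
  (s : 'I_n -> mpoly K n)
  (s_nz : forall i, s i != 0)
  (phi_x : forall i : 'I_n, phi (mvar K n i) = s i * mvar K n i) :
  (* H_l(FK) = 0 for every l >= 1 *)
  (forall (l : nat) (c : kvec K n), (1 <= l)%N -> khomog l c ->
     kbound phi s c = 0 ->
     exists d : kvec K n, khomog l.+1 d /\ kbound phi s d = c)
  /\
  (* H_0(FK) = FK_0 / im d_1 is isomorphic to S/I_n as a left
     S[Theta;phi]-module: there is a left-linear surjection
     eps : FK_0 -> S/I_n whose kernel is im d_1 *)
  (exists eps : {poly mpoly K n} -> mpoly K n,
     (forall p q, inIn (eps (p + q) - (eps p + eps q))) /\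
     (forall p q, inIn (eps (skmul phi p q) - skact phi p (eps q))) /\
     (forall m, exists p, inIn (eps p - m)) /\
     (forall p, inIn (eps p) <->
        exists d : kvec K n, khomog 1 d /\ kbound phi s d = kzero p)).
Proof.
split=> [l c l_gt0 lc dc|].
  have c0 : c (set0, false) = 0.
    apply/eqP; apply: contraTT l_gt0 => /lc <-.
    by rewrite /kdeg cards0.
  have [d dE] := kbound_exact phi_flat phi_x dc c0.
  exists (ktrunc l.+1 d); split; first exact: khomog_trunc.
  rewrite kbound_trunc dE; apply/ffunP => k; rewrite ffunE.
  by case: ifPn => // kl; apply/esym/eqP; apply: contraNT kl => /lc/eqP.
have inInE a : inIn a <-> in_span n (mvar K n) a.
  split=> [[g ->]|[h ->]]; last by exists (fun j => h j).
  by apply: in_span_sum => j _; apply: in_spanM.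
have inIn0 : inIn (0 : mpoly K n) by apply/inInE/in_span0.
(* The augmentation is the sum of the coefficients, Theta being sent to 1. *)
exists (horner^~ 1); split; [|split; [|split]].
- by move=> p q; rewrite hornerD subrr.
(* Left linearity holds already in S, by additivity of the iterates of [phi]. *)
- move=> p q; suff -> : (skmul phi p q).[1] = skact phi p q.[1] by rewrite subrr.
  rewrite horner_sum; apply: eq_bigr => i _; rewrite horner_sum horner_coef.
  have [f fE] := iter_rmorphism phi i.
  rewrite -fE rmorph_sum big_distrr; apply: eq_bigr => j _ /=.
  by rewrite !hornerE !expr1n !mulr1 -fE.
- by move=> m; exists m%:P; rewrite hornerC subrr.
by move=> p; rewrite inInE; apply: kbound_image phi_x p.
Qed.
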